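(* Let $l\ge2$ and $Q_l=\mathcal{A}_1\oplus\mathcal{A}_l$. If $P$ is a finite $Q_l$-optimal poset, then $P$ has an $l$-decomposition.
   Context: All posets are finite. $\mathcal{A}_n$ denotes the antichain on $n$ elements. The ordinal sum $P\oplus Q$ is the poset on the disjoint union $P\cup Q$ with $x\le y$ iff $x\le y$ in $P$, or $x\le y$ in $Q$, or $x\in P$ and $y\in Q$. A poset is layered if it is an ordinal sum of antichains. For posets $P,Q$, $c_Q(P)$ is the number of subsets of $P$ whose induced subposet is isomorphic to $Q$; $M_{n,Q}=\max\{c_Q(P):|P|=n\}$; $P$ is $Q$-optimal if $c_Q(P)=M_{|P|,Q}$. $P=P_1\oplus P_2$ is an $l$-decomposition of $P$ if $P_2$ is layered (possibly empty) and every subset $A\subseteq P$ whose induced subposet is isomorphic to $\mathcal{A}_1\oplus\mathcal{A}_l$ satisfies $|A\cap P_1|\le 1$. *)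

(* Defs.v *)
From HB Require Import structures.
From mathcomp Require Import all_boot all_order.

Set Implicit Arguments.
Unset Strict Implicit.
Unset Printing Implicit Defensive.

Import Order.Theory.

Local Open Scope order_scope.

(* Displays only steer the printing of order relations, so one display serves
   for every poset built below. *)
Fact poset_display : Order.disp_t. Proof. exact: Order.Disp tt tt. Qed.

Section Antichain.

(* An alias of 'I_n, because 'I_n itself carries the usual total order. *)
Definition antichain (n : nat) : Type := 'I_n.

Variable n : nat.

HB.instance Definition _ := Finite.on (antichain n).

Definition antichain_le (x y : antichain n) : bool := x == y.

Fact antichain_le_refl : reflexive antichain_le.
Proof. exact: eqxx. Qed.

Fact antichain_le_anti : antisymmetric antichain_le.
Proof. by move=> x y /andP[/eqP]. Qed.

Fact antichain_le_trans : transitive antichain_le.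
Proof. by move=> y x z /eqP-> /eqP->; apply: eqxx. Qed.

HB.instance Definition _ := Order.Le_isPOrder.Build poset_display (antichain n)
  antichain_le_refl antichain_le_anti antichain_le_trans.

End Antichain.

Section OrdinalSum.

Variables (d1 d2 : Order.disp_t) (P : finPOrderType d1) (Q : finPOrderType d2).

Definition ordsum : Type := (P + Q)%type.

HB.instance Definition _ := Finite.on ordsum.

Definition ordsum_le (x y : ordsum) : bool :=
  match x, y with
  | inl p, inl p' => p <= p'
  | inr q, inr q' => q <= q'
  | inl _, inr _ => true
  | inr _, inl _ => false
  end.

Fact ordsum_le_refl : reflexive ordsum_le.
Proof. by case=> x /=. Qed.

Fact ordsum_le_anti : antisymmetric ordsum_le.
Proof. by case=> [x|x] [y|y] //= /le_anti ->. Qed.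

Fact ordsum_le_trans : transitive ordsum_le.
Proof. by case=> [y|y] [x|x] [z|z] //=; apply: le_trans. Qed.

HB.instance Definition _ := Order.Le_isPOrder.Build poset_display ordsum
  ordsum_le_refl ordsum_le_anti ordsum_le_trans.

End OrdinalSum.

Arguments ordsum {d1 d2} P Q.

Section Induced.

Variables (d : Order.disp_t) (P : finPOrderType d) (A : {set P}).

Definition induced : Type := {x : P | x \in A}.

HB.instance Definition _ := SubFinite.on induced.
HB.instance Definition _ :=
  [SubChoice_isSubPOrder of induced by <: with poset_display].

End Induced.

Section Isomorphism.

Variables (d1 d2 : Order.disp_t) (P : finPOrderType d1) (Q : finPOrderType d2).

Definition order_iso (f : P -> Q) : Prop :=
  bijective f /\ {mono f : x y / x <= y}.

(* Boolean, so that the copies of a poset can be counted. *)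
Definition isomorphic : bool :=
  [exists f : {ffun P -> Q},
    [&& injectiveb f, #|P| == #|Q| & [forall x, forall y, (f x <= f y) == (x <= y)]]].

Lemma isomorphicP : reflect (exists f : P -> Q, order_iso f) isomorphic.
Proof.
apply: (iffP existsP) => [[f /and3P[/injectiveP fI /eqP cPQ /forallP fM]]|].
  exists f; split; first by apply: inj_card_bij; rewrite ?cPQ.
  by move=> x y; apply/eqP/(forallP (fM x)).
case=> f [fB fM]; exists (finfun f); apply/and3P; split.
- by apply/injectiveP => x y; rewrite !ffunE; apply: bij_inj.
- by rewrite (bij_eq_card fB).
- by apply/forallP => x; apply/forallP => y; rewrite !ffunE fM.
Qed.

End Isomorphism.

Arguments isomorphic {d1 d2} P Q.

Fixpoint antichain_sum (ns : seq nat) : finPOrderType poset_display :=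
  if ns is n :: ns' then ordsum (antichain n) (antichain_sum ns')
  else antichain 0.

(* Zero entries and the empty list are allowed: A_0 is neutral for ordsum, so
   they only add the empty poset. *)
Definition layered (d : Order.disp_t) (P : finPOrderType d) : Prop :=
  exists ns : seq nat, isomorphic P (antichain_sum ns).

Definition copies (dQ dP : Order.disp_t) (Q : finPOrderType dQ)
    (P : finPOrderType dP) : nat :=
  #|[set A : {set P} | isomorphic (induced A) Q]|.

(* m = M_{n,Q} *)
Definition is_max_copies (dQ : Order.disp_t) (Q : finPOrderType dQ)
    (n m : nat) : Prop :=
  (exists (d : Order.disp_t) (P : finPOrderType d),
     #|P| = n /\ copies Q P = m) /\
  (forall (d : Order.disp_t) (P : finPOrderType d),
     #|P| = n -> (copies Q P <= m)%N).

Definition optimal (dQ dP : Order.disp_t) (Q : finPOrderType dQ)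
    (P : finPOrderType dP) : Prop :=
  is_max_copies Q #|P| (copies Q P).

Definition star (l : nat) : finPOrderType poset_display :=
  ordsum (antichain 1) (antichain l).

(* The identification of P with the external ordinal sum of P1 and P2 is an
   isomorphism f; the copy of P1 inside P is the image of f \o inl. *)
Definition l_decomposition (l : nat) (d d1 d2 : Order.disp_t)
    (P : finPOrderType d) (P1 : finPOrderType d1) (P2 : finPOrderType d2)
    (f : ordsum P1 P2 -> P) : Prop :=
  [/\ order_iso f,
      layered P2 &
      forall A : {set P}, isomorphic (induced A) (star l) ->
        (#|A :&: [set f (inl p) | p : P1]| <= 1)%N].

Definition has_l_decomposition (l : nat) (d : Order.disp_t)
    (P : finPOrderType d) : Prop :=
  exists (d1 d2 : Order.disp_t) (P1 : finPOrderType d1)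
      (P2 : finPOrderType d2) (f : ordsum P1 P2 -> P),
    l_decomposition l f.

(* Main.v *)
Require Import Defs.
From HB Require Import structures.
From mathcomp Require Import all_boot all_order.
From mathcomp Require Import perm zify.

Set Implicit Arguments.
Unset Strict Implicit.
Unset Printing Implicit Defensive.

(* In an optimal poset containing a copy of Q_l, every non-maximal element lies
   below every maximal one.  Take x with the largest down-set, hence maximal,
   and a maximal y with another down-set.  Making y a twin of x, or x a twin of
   y, cannot increase the number of copies; comparing both replacements shows
   that the first one keeps optimality and that every copy through both x and y
   in the new poset was already a copy.  By induction on the number of twins of
   x the claim holds for the new poset, so each a < x is the apex of a copy
   through x and y, whence a < y in the old poset: the down-set of y would
   contain that of x.  Therefore P is the ordinal sum of its non-maximal
   elements, which again form an optimal poset, and an antichain.  Peeling off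
   antichains until no copy is left gives the decomposition. *)

(** * Strict orders on a finite set and their stars *)

Section Relations.

Variables (T : finType) (l : nat).
Hypothesis l_gt1 : 1 < l.

Implicit Types (r : rel T) (U S D : {set T}) (x y z a b : T).

(* Orders on a subset U are relations on T supported on U, so that U can shrink
   in the induction without changing the carrier type. *)
Definition strict_on U r : Prop :=
  [/\ irreflexive r, transitive r & forall a b, r a b -> (a \in U) && (b \in U)].

(* A copy of Q_l is recorded as the pair (apex, set of l leaves); the leaves lie
   in U because the apex is below them. *)
Definition stars r : {set T * {set T}} :=
  [set p : T * {set T} | [&& #|p.2| == l, [forall a in p.2, r p.1 a]
                           & [forall a in p.2, forall b in p.2, ~~ r a b]]].

Lemma starsP r z S :
  reflect [/\ #|S| = l, {in S, forall a, r z a} & {in S &, forall a b, ~~ r a b}]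
          ((z, S) \in stars r).
Proof.
rewrite inE /=; apply: (iffP and3P) => [[/eqP cS /forall_inP rS aS]|[cS rS aS]].
  by split=> // a b Sa Sb; move/forall_inP/(_ a Sa)/forall_inP/(_ b Sb): aS.
split; [exact/eqP | exact/forall_inP |].
by apply/forall_inP => a Sa; apply/forall_inP => b Sb; apply: aS.
Qed.

Definition optimal_on U r : Prop :=
  strict_on U r /\ forall r', strict_on U r' -> #|stars r'| <= #|stars r|.

Definition maximals U r : {set T} := [set y in U | [forall b, ~~ r y b]].

Lemma maximalsP U r y :
  reflect (y \in U /\ forall b, r y b = false) (y \in maximals U r).
Proof.
rewrite inE; apply: (iffP andP) => [[Uy /forallP ymax]|[Uy ymax]]; split=> //.
  by move=> b; apply/negbTE.
by apply/forallP => b; rewrite ymax.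
Qed.

Definition below r y : {set T} := [set a | r a y].

Lemma card_below_lt U r a b :
  strict_on U r -> r a b -> #|below r a| < #|below r b|.
Proof.
case=> rI rT _ ab; apply: proper_card; apply/properP; split.
  by apply/subsetP => c; rewrite !inE => /rT; apply.
by exists a; rewrite !inE // rI.
Qed.

Lemma exists_maximal_above U r a b :
  strict_on U r -> r a b -> exists2 m, m \in maximals U r & r a m.
Proof.
move=> sr ab; have [rI rT rU] := sr.
have [m am m_max] := @arg_maxnP _ b (fun m => r a m) (fun m => #|below r m|) ab.
exists m => //; apply/maximalsP; split; first by case/andP: (rU _ _ am).
move=> c; apply/negP => mc; have := m_max c (rT _ _ _ am mc).
by rewrite /= leqNgt (card_below_lt sr mc).
Qed.

Lemma star_nonempty r z S : (z, S) \in stars r -> exists a, a \in S.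
Proof. by case/starsP=> cS _ _; apply/card_gt0P; rewrite cS; apply: ltnW. Qed.

Lemma star_apex_nonmax U r z S y :
  (z, S) \in stars r -> y \in maximals U r -> z != y.
Proof.
move=> zS /maximalsP[_ ymax]; apply/eqP => zy.
by have [a Sa] := star_nonempty zS; case/starsP: zS => _ /(_ a Sa); rewrite zy ymax.
Qed.

(* Otherwise moving [x] to the very bottom would create new stars. *)
Lemma maximal_in_star U r x :
  optimal_on U r -> 0 < #|stars r| -> x \in maximals U r ->
  exists2 p, p \in stars r & x \in p.2.
Proof.
case=> [[rI rT rU] ropt] /card_gt0P[[z0 S0] star0] xM.
have [|no_star] := boolP [exists p in stars r, x \in p.2].
  by case/exists_inP => p; exists p.
have xS z S : (z, S) \in stars r -> x \notin S.
  by move=> zS; move/exists_inPn: no_star => /(_ _ zS).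
pose r' a b := (b != x) && (if a == x then b \in U else r a b).
have [Ux xmax] := maximalsP _ _ _ xM.
have sr' : strict_on U r'.
  split=> [a|b a c|a b]; rewrite /r'.
  - by case: eqVneq => //=; rewrite rI.
  - move=> /andP[bx ab] /andP[-> /=]; rewrite (negbTE bx).
    case: eqP ab => [_ _ /rU/andP[_ ->] //|_]; exact: rT.
  - by case/andP=> _; case: eqP => [-> ->|_ /rU//]; rewrite Ux.
have : stars r \proper stars r'.
  apply/properP; split; last first.
    (* [S0] avoids [x], so [x], moved to the bottom, becomes an apex over it; the maximal [x] was no
       apex before. *)
    exists (x, S0); last by apply/negP => /star_apex_nonmax/(_ xM); rewrite eqxx.
    have xS0 := xS _ _ star0; have [cS rS aS] := starsP _ _ _ star0.
    apply/starsP; split=> // [a Sa|a b Sa Sb]; rewrite /r'.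
      rewrite eqxx; have /rU/andP[_ ->] := rS a Sa.
      by rewrite andbT; apply: contraNneq xS0 => <-.
    case: (eqVneq a x) Sa xS0 => [-> -> //|_ Sa _].
    by rewrite negb_and aS // orbT.
  apply/subsetP => -[z S] zS; have xnS := xS _ _ zS.
  have zx := star_apex_nonmax zS xM; have [cS rS aS] := starsP _ _ _ zS.
  apply/starsP; split=> // [a Sa|a b Sa Sb]; rewrite /r'.
    by rewrite (negbTE zx) rS // andbT; apply: contraNneq xnS => <-.
  case: (eqVneq a x) Sa xnS => [-> -> //|_ Sa _].
  by rewrite negb_and aS // orbT.
by move/proper_card; rewrite ltnNge ropt.
Qed.

(** * Twins of maximal elements *)

(* y becomes a twin of x; meant for maximal x and y. *)
Definition twin r x y : rel T := fun a b => (a != y) && r a (if b == y then x else b).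

Definition through x : {set T * {set T}} := [set p : T * {set T} | x \in p.2].

Lemma twin_strict U r x y :
  strict_on U r -> x \in maximals U r -> y \in maximals U r ->
  strict_on U (twin r x y).
Proof.
move=> [rI rT rU] /maximalsP[Ux xmax] /maximalsP[Uy ymax]; split.
- by move=> a; rewrite /twin; case: eqP => //= _; rewrite rI.
- move=> b a c /andP[ay ab] /andP[/negbTE yb bc]; rewrite /twin ay /=.
  by move: ab; rewrite yb => /rT; apply.
- by move=> a b /andP[_]; case: eqP => [-> /rU|_ /rU//]; rewrite Ux Uy.
Qed.

Lemma below_twin U r x y a : y \in maximals U r ->
  below (twin r x y) a = below r (if a == y then x else a).
Proof.
move=> /maximalsP[_ ymax]; apply/setP => b; rewrite !inE /twin.
by case: (eqVneq b y) => [->|]; rewrite ?ymax.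
Qed.

Lemma maximals_twin U r x y : maximals U r \subset maximals U (twin r x y).
Proof.
apply/subsetP => a /maximalsP[Ua amax]; apply/maximalsP.
by split=> // b; rewrite /twin amax andbF.
Qed.

(** [r] and [twin r x y] agree away from [y], and an apex is never the maximal [y]. *)
Lemma stars_twin_avoid U r x y : y \in maximals U r ->
  stars r :\: through y \subset stars (twin r x y) :\: through y.
Proof.
move=> yM; apply/subsetP => -[z S]; rewrite !in_setD /=.
rewrite ![_ \in through _]inE /= => /andP[yS zS]; rewrite yS /=.
have zy := star_apex_nonmax zS yM; have [cS rS aS] := starsP _ _ _ zS.
have neq a : a \in S -> (a == y) = false.
  by move=> Sa; apply/negbTE; apply: contraNneq yS => <-.
apply/starsP; split=> // [a Sa|a b Sa Sb]; rewrite /twin /=.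
  by rewrite zy neq ?rS.
by rewrite neq // neq // aS ?andbF.
Qed.

(** The leaf [y] inherits the strict lower bounds of the leaf [x], among them the apex and no
    leaf. *)
Lemma stars_twin_both U r x y : x \in maximals U r -> y \in maximals U r ->
  stars r :&: through y :&: through x
    \subset stars (twin r x y) :&: through y :&: through x.
Proof.
move=> xM yM; apply/subsetP => -[z S]; rewrite !in_setI ![_ \in through _]inE /=.
move=> /andP[/andP[zS yS] xS]; rewrite yS xS !andbT.
have zy := star_apex_nonmax zS yM; have [cS rS aS] := starsP _ _ _ zS.
apply/starsP; split=> // [a Sa|a b Sa Sb]; rewrite /twin.
  by rewrite zy /=; case: eqP => _; apply: rS.
by rewrite negb_and; case: (b == y); rewrite aS // orbT.
Qed.

Lemma card_stars_twin_new U r x y : x != y -> y \in maximals U r ->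
  #|(stars r :\: through y) :&: through x|
    <= #|(stars (twin r x y) :&: through y) :\: through x|.
Proof.
move=> xy yM.
(* Swapping x and y turns a star through x into one through y. *)
pose h (p : T * {set T}) := (p.1, [set tperm x y a | a in p.2]).
have h_inj : injective h.
  move=> [z S] [z' S'] [-> /(imset_inj (@perm_inj _ _)) -> //].
rewrite -(card_imset _ h_inj); apply: subset_leq_card.
apply/subsetP => _ /imsetP[[z S] + ->].
rewrite !(in_setI, in_setD) ![_ \in through _]inE /= => /andP[/andP[yS zS] xS].
have zy := star_apex_nonmax zS yM; have [cS rS aS] := starsP _ _ _ zS.
(* [twin] reads the target [y] as [x]; after the swap this recovers each leaf in [S], as [y] is not
   among them. *)
have tE a : a \in S -> (if tperm x y a == y then x else tperm x y a) = a.
  move=> Sa; case: tpermP => [-> | ay | _ /eqP/negbTE -> //].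
    by rewrite eqxx.
  by rewrite -ay Sa in yS.
apply/and3P; split.
- apply/negP => /imsetP[a Sa /esym xE]; have := tE a Sa.
  by rewrite xE (negbTE xy) => ax; move: xE xy; rewrite -ax tpermL => ->; rewrite eqxx.
- apply/starsP; split=> [|_ /imsetP[a Sa ->]|_ _ /imsetP[a Sa ->] /imsetP[b Sb ->]].
  + by rewrite card_imset //; apply: perm_inj.
  + by rewrite /twin /= zy tE // rS.
  + rewrite /twin /= tE // negb_and negbK.
    by move: (tE a Sa); case: eqVneq => //= _ ->; apply: aS.
- by apply/imsetP; exists x => //; rewrite tpermL.
Qed.

(** Sort the stars of [r] by whether their leaves contain only [x], only [y], both or neither. In
    [twin r x y] the first, third and fourth classes do not shrink, and the second is at least as
    large as the first was in [r]. Optimality then bounds the first class of [r] by its second. The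
    opposite replacement gives the converse bound, so every estimate is tight, and the inclusion
    between the stars through both is an equality. *)
Lemma optimal_twin U r x y :
  optimal_on U r -> x != y -> x \in maximals U r -> y \in maximals U r ->
  [/\ optimal_on U (twin r x y), #|stars (twin r x y)| = #|stars r| &
      forall z S, (z, S) \in stars (twin r x y) -> x \in S -> y \in S ->
        (z, S) \in stars r].
Proof.
move=> [sr ropt] xy xM yM.
have le1 := ropt _ (twin_strict sr xM yM).
have le2 := ropt _ (twin_strict sr yM xM).
have av1 := subset_leq_card (stars_twin_avoid x yM).
have av2 := subset_leq_card (stars_twin_avoid y xM).
have sub1 := stars_twin_both xM yM.
have bo1 := subset_leq_card sub1.
have bo2 := subset_leq_card (stars_twin_both yM xM).
have nw1 := card_stars_twin_new xy yM.
have nw2 : #|(stars r :\: through x) :&: through y| <=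
    #|(stars (twin r y x) :&: through x) :\: through y|.
  by apply: (card_stars_twin_new _ xM); rewrite eq_sym.
have e1 := cardsID (through y) (stars (twin r x y)).
have e1' := cardsID (through x) (stars (twin r x y) :&: through y).
have e2 := cardsID (through x) (stars (twin r y x)).
have e2' := cardsID (through y) (stars (twin r y x) :&: through x).
have e3 := cardsID (through y) (stars r).
have e3' := cardsID (through x) (stars r :&: through y).
have e4 := cardsID (through x) (stars r).
have e4' := cardsID (through y) (stars r :&: through x).
rewrite setIDAC in nw1; rewrite setIDAC in nw2.
rewrite (setIAC (stars r) (through x)) in e4' bo2.
have cE : #|stars (twin r x y)| = #|stars r| by lia.
have sE : stars r :&: through y :&: through x =
          stars (twin r x y) :&: through y :&: through x.
  by apply/eqP; rewrite eqEcard sub1; lia.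
split=> //.
  by split=> [|r' sr']; [exact: twin_strict | rewrite cE ropt].
move=> z S zS xS yS; have : (z, S) \in stars (twin r x y) :&: through y :&: through x.
  by rewrite !in_setI zS ![_ \in through _]inE /= xS yS.
by rewrite -sE !in_setI -andbA => /andP[].
Qed.

(** * Domination by the maximal elements *)

Lemma exists_set_through (M S : {set T}) x y :
  1 < #|S| -> S \subset M -> x \in S -> y \in M ->
  exists S', [/\ #|S'| = #|S|, S' \subset M, x \in S' & y \in S'].
Proof.
move=> S1 SM xS yM; have [yS|yS] := boolP (y \in S); first by exists S.
(* An element other than [x] is traded for [y]; this is where at least two leaves are required. *)
have /card_gt0P[s] : 0 < #|S :\ x| by have := cardsD1 x S; rewrite xS; lia.
rewrite in_setD1 => /andP[sx sS]; exists (y |: S :\ s); split.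
- by rewrite cardsU1 in_setD1 (negbTE yS) andbF (cardsD1 s S) sS.
- by rewrite subUset sub1set yM (subset_trans _ SM) // subD1set.
- by rewrite in_setU1 in_setD1 [x == s]eq_sym sx xS orbT.
- exact: setU11.
Qed.

Definition tops_dominate U r : Prop :=
  {in U & maximals U r, forall z y, z \notin maximals U r -> r z y}.

(** A non-maximal leaf would lie below the leaf [x]. *)
Lemma star_in_maximals U r z S x : strict_on U r -> tops_dominate U r ->
  (z, S) \in stars r -> x \in maximals U r -> x \in S -> S \subset maximals U r.
Proof.
move=> [_ _ rU] top /starsP[_ rS aS] xM xS; apply/subsetP => s Ss.
apply/negPn/negP => sM; have /rU/andP[_ Us] := rS s Ss.
by have := top s x Us xM sM; rewrite (negbTE (aS _ _ Ss xS)).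
Qed.

Lemma star_over_maximals U r z S : tops_dominate U r ->
  z \in U -> z \notin maximals U r -> S \subset maximals U r -> #|S| = l ->
  (z, S) \in stars r.
Proof.
move=> top Uz zM /subsetP SM cS; apply/starsP; split=> // [a|a b] Sa.
  exact: top Uz (SM a Sa) zM.
by have /maximalsP[_ ->] := SM a Sa.
Qed.

Lemma optimal_tops_dominate U r :
  optimal_on U r -> 0 < #|stars r| -> tops_dominate U r.
Proof.
move=> ropt r_gt0; have [[z0 S0] zS0] := card_gt0P r_gt0.
have [x _ x_max] := @arg_maxnP _ z0 xpredT (fun a => #|below r a|) isT.
have {x_max}x_max a : #|below r a| <= #|below r x| by apply: x_max.
pose twins r := [set y in maximals U r | below r y == below r x].
(* The induction is on the number of elements of [U] outside [twins r]; [x] stays fixed while [r]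
   changes. *)
have [n le_n] := ubnP (#|U| - #|twins r|).
elim: n => // n IHn in r ropt r_gt0 x_max le_n {z0 S0 zS0} *.
have [sr _] := ropt; have [rI rT rU] := sr.
(* A leaf has a non-empty down-set, hence so has [x], which puts it in [U]; anything above [x] would
   have a larger down-set. *)
have xM : x \in maximals U r.
  have [[z S] zS] := card_gt0P r_gt0; have [s Ss] := star_nonempty zS.
  have [_ /(_ s Ss) zs _] := starsP _ _ _ zS.
  have /card_gt0P[a] : 0 < #|below r x|.
    by apply: leq_trans (x_max s); apply/card_gt0P; exists z; rewrite inE.
  rewrite inE => /rU/andP[_ Ux]; apply/maximalsP; split=> // c.
  by apply/negP => /(card_below_lt sr); rewrite ltnNge x_max.
have [/forall_inP all_twins|] :=
  boolP [forall y in maximals U r, below r y == below r x].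
  move=> z y Uz yM zM; have [b zb] : exists b, r z b.
    apply/existsP; apply: contraNT zM; rewrite negb_exists => /forallP zmax.
    by apply/maximalsP; split=> // b; apply/negbTE/zmax.
  have [m mM zm] := exists_maximal_above sr zb.
  have: z \in below r m by rewrite inE.
  by rewrite (eqP (all_twins m mM)) -(eqP (all_twins y yM)) inE.
case/forall_inPn => y yM y_ntwin.
have xy : x != y by apply: contraNneq y_ntwin => ->.
have [ropt' cE both] := optimal_twin ropt xy xM yM.
set r' := twin r x y in ropt' cE both; have [sr' _] := ropt'.
have bE a : below r' a = below r (if a == y then x else a) by apply: below_twin yM.
have MM : maximals U r \subset maximals U r' by apply: maximals_twin.
have xM' := subsetP MM _ xM; have yM' := subsetP MM _ yM.
(* [y] joins the twins of [x] and none is lost, so the induction hypothesis applies to [r']. *)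
have top' : tops_dominate U r'.
  apply: IHn; rewrite ?cE //; first by move=> a; rewrite !bE (negbTE xy).
  suff : twins r \proper twins r'.
    move/proper_card; have : #|twins r'| <= #|U|.
      by apply/subset_leq_card/subsetP => a; rewrite !inE => /andP[/andP[]].
    by move: le_n; lia.
  apply/properP; split; last first.
    by exists y; rewrite inE ?(negbTE y_ntwin) ?andbF // yM' !bE eqxx (negbTE xy) eqxx.
  apply/subsetP => a; rewrite inE => /andP[aM aE]; rewrite inE (subsetP MM _ aM).
  by rewrite !bE (negbTE xy); case: (a == y) => //=.
have r'_gt0 : 0 < #|stars r'| by rewrite cE.
have [[z1 S1] zS1 /= xS1] := maximal_in_star ropt' r'_gt0 xM'.
have [cS1 _ _] := starsP _ _ _ zS1.
have S1M := star_in_maximals sr' top' zS1 xM' xS1.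
have S1_gt1 : 1 < #|S1| by rewrite cS1.
(* [S] contains [x] and [y] and consists of maximal elements of [r'], so by [top'] each [a] below
   [x] is the apex of a star over it; [both] carries this star back to [r]. *)
have [S [cS SM xS yS]] := exists_set_through S1_gt1 S1M xS1 yM'.
suff sub : below r x \subset below r y.
  by case/negP: y_ntwin; rewrite eq_sym eqEcard sub x_max.
apply/subsetP => a; rewrite !inE => ax.
have zS : (a, S) \in stars r'.
  apply: star_over_maximals SM _ => //; last by rewrite cS.
    by case/andP: (rU _ _ ax).
  apply: contraL ax => /maximalsP[_ /(_ x)]; rewrite /r' /twin (negbTE xy).
  have /maximalsP[_ ymax] := yM; case: eqVneq => [-> _|_ /= ->] //.
  by rewrite ymax.
by case/starsP: (both _ _ zS xS yS) => _ /(_ y yS).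
Qed.


(** * Ordinal sum with an antichain on top, and peeling it off *)

Definition stack (R M : {set T}) r : rel T :=
  fun a b => r a b || (a \in R) && (b \in M).

Lemma stack_strict (R M : {set T}) r : [disjoint R & M] -> strict_on R r ->
  strict_on (R :|: M) (stack R M r).
Proof.
move=> dRM [rI rT rU]; rewrite /stack; split=> [a|b a c|a b].
- by rewrite rI /=; apply/negP => /andP[aR]; rewrite (disjointFr dRM aR).
- case/orP=> [ab|/andP[aR bM]] /orP[bc|/andP[bR cM]].
  + by rewrite (rT _ _ _ ab bc).
  + by case/andP: (rU _ _ ab) => -> _; rewrite cM orbT.
  + by case/andP: (rU _ _ bc); rewrite (disjointFl dRM bM).
  + by rewrite (disjointFl dRM bM) in bR.
- by rewrite !in_setU => /orP[/rU/andP[-> ->]|/andP[-> ->]]; rewrite ?orbT.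
Qed.

(** A leaf in [M] excludes leaves in [R], which would lie below it. So either all leaves are in [M],
    over any apex from [R], or none is, and the star is one of [r]. *)
Lemma stars_stack (R M : {set T}) r : [disjoint R & M] -> strict_on R r ->
  stars (stack R M r) =
  stars r :|: [set p : T * {set T} | [&& p.1 \in R, p.2 \subset M & #|p.2| == l]].
Proof.
move=> dRM [rI rT rU]; apply/setP => -[z S]; rewrite in_setU [X in _ || X]inE /=.
apply/idP/orP => [zS|[zS|/and3P[zR /subsetP SM /eqP cS]]].
- have [cS rS aS] := starsP _ _ _ zS.
  have [/exists_inP[s Ss sM]|noM] := boolP [exists s in S, s \in M]; [right|left].
    have sR := disjointFl dRM sM.
    have zR : z \in R.
      by case/orP: (rS s Ss) => [/rU/andP[]|/andP[]].
    rewrite zR cS eqxx andbT /=; apply/subsetP => t St.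
    case/orP: (rS t St) => [/rU/andP[_ tR]|/andP[_ //]].
    by have := aS t s St Ss; rewrite /stack tR sM orbT.
  have SnM s : s \in S -> (s \in M) = false.
    by move=> Ss; apply/negbTE; move/exists_inPn: noM; apply.
  apply/starsP; split=> // [s Ss|a b Sa Sb].
    by have := rS s Ss; rewrite /stack SnM // andbF orbF.
  by have := aS a b Sa Sb; rewrite /stack SnM // andbF orbF.
- have [cS rS aS] := starsP _ _ _ zS; apply/starsP; split=> // [s Ss|a b Sa Sb].
    by rewrite /stack rS.
  rewrite /stack negb_or aS // (disjointFr dRM) ?andbF //.
  by case/andP: (rU _ _ (rS b Sb)).
- apply/starsP; split=> // [s Ss|a b Sa Sb]; rewrite /stack.
    by rewrite zR SM ?orbT.
  rewrite (disjointFl dRM (SM a Sa)) orbF; apply/negP => /rU/andP[].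
  by rewrite (disjointFl dRM (SM a Sa)).
Qed.

(** The second summand does not depend on [r], so a better order on [R] gives a better stack. *)
Lemma card_stars_stack (R M : {set T}) r : [disjoint R & M] -> strict_on R r ->
  #|stars (stack R M r)| =
  #|stars r| + #|[set p : T * {set T} | [&& p.1 \in R, p.2 \subset M & #|p.2| == l]]|.
Proof.
move=> dRM sr; rewrite stars_stack // cardsU disjoint_setI0 ?cards0 ?subn0 //.
rewrite -setI_eq0; apply/eqP/setP => -[z S]; rewrite in_setI in_set0 [X in _ && X]inE /=.
apply/negP => /andP[zS /and3P[_ /subsetP SM _]]; have [a Sa] := star_nonempty zS.
have [_ /(_ a Sa) za _] := starsP _ _ _ zS; case: sr => _ _ /(_ _ _ za)/andP[_].
by rewrite (disjointFl dRM (SM a Sa)).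
Qed.

(** By [top], [r] is the stack of its restriction to [R] and its maximal elements, so a better order
    on [R] would improve [r]. *)
Lemma optimal_nonmaximals U r : optimal_on U r -> tops_dominate U r ->
  let R := U :\: maximals U r in
  optimal_on R (fun a b => r a b && (b \in R)).
Proof.
move=> [[rI rT rU] ropt] top R; set r0 := fun a b => _.
have sr0 : strict_on R r0.
  rewrite /r0; split=> [a|b a c|a b]; first by rewrite rI.
    by move=> /andP[ab _] /andP[bc ->]; rewrite (rT _ _ _ ab bc).
  (* [a] is in [R] as well, because an element below another one is not maximal. *)
  case/andP=> ab bR; rewrite bR andbT in_setD; case/andP: (rU _ _ ab) => -> _.
  by rewrite andbT; apply/negP => /maximalsP[_ amax]; rewrite amax in ab.
have dRM : [disjoint R & maximals U r].
  by rewrite -setI_eq0 setIDAC setDIl setDv setI0.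
have URM : U = R :|: maximals U r.
  by apply/setP => a; rewrite in_setU in_setD inE; case: (a \in U) => //=; case: forallP.
have rE : stars r = stars (stack R (maximals U r) r0).
  suff rel_eq : r =2 stack R (maximals U r) r0.
    apply/setP => -[z S]; apply/starsP/starsP => -[cS rS aS]; split=> //.
    + by move=> a Sa; rewrite -rel_eq rS.
    + by move=> a b Sa Sb; rewrite -rel_eq aS.
    + by move=> a Sa; rewrite rel_eq rS.
    + by move=> a b Sa Sb; rewrite rel_eq aS.
  move=> a b; rewrite /stack /r0; have [ab|] /= := boolP (r a b).
    have aM : a \notin maximals U r.
      by apply/negP => /maximalsP[_ amax]; rewrite amax in ab.
    case/andP: (rU _ _ ab) => Ua Ub; rewrite !in_setD Ua Ub aM /=.
    by case: (b \in _).
  move=> nab; symmetry; apply: contraNF nab => /andP[].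
  rewrite in_setD => /andP[aM Ua] bM.
  exact: top.
split=> // r' sr'.
have := ropt (stack R (maximals U r) r'); rewrite rE !card_stars_stack // leq_add2r.
by apply; rewrite [X in strict_on X]URM; apply: stack_strict.
Qed.

(** [D] will be the lower summand and [h] the layer number above it. With no leaf in [D], a copy can
    meet it only in its apex, which is the bound [|A ∩ P_1| <= 1]. Each induction step removes the
    maximal elements as one layer. *)
Lemma optimal_decomposition U r : optimal_on U r ->
  exists (D : {set T}) (h : T -> nat),
    [/\ {in D & U :\: D, forall x y, r x y},
        {in U :\: D &, forall x y, r x y = (h x < h y)} &
        forall z S, (z, S) \in stars r -> [disjoint S & D]].
Proof.
have [n] := ubnP #|U|; elim: n => // n IHn in U r * => leUn ropt.
have [[rI rT rU] _] := ropt.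
have [stars0|] := posnP #|stars r|.
  (* With no star left, all of [U] is the lower summand; [h] takes a default value. *)
  exists U, (fun=> 0); rewrite setDv; split=> [x y|x y|z S]; rewrite ?in_set0 //.
  by move/eqP: stars0; rewrite cards_eq0 => /eqP->; rewrite in_set0.
move=> r_gt0; have top := optimal_tops_dominate ropt r_gt0.
have := optimal_nonmaximals ropt top; set R := U :\: _ => /= ropt0.
set M := maximals U r in R ropt0.
have ltRU : #|R| < #|U|.
  have [[z S] zS] := card_gt0P r_gt0; have [s Ss] := star_nonempty zS.
  have [_ /(_ s Ss) zs _] := starsP _ _ _ zS.
  have [m mM _] := exists_maximal_above ropt.1 zs; apply: proper_card.
  apply/properP; split; first exact: subsetDl.
  by exists m; [have /maximalsP[] := mM | rewrite in_setD mM].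
have [|D [h [rD rh starsD]]] := IHn _ _ _ ropt0; first by move: leUn ltRU; lia.
have UP a : a \in U -> a \in R \/ a \in M.
  by move=> Ua; rewrite in_setD Ua andbT; case: (a \in M); [right|left].
have MR a : a \in M -> (a \in R) = false by move=> aM; rewrite in_setD aM.
have topRM a b : a \in R -> b \in M -> r a b.
  by rewrite in_setD => /andP[aM Ua] bM; apply: top.
clearbody R.
have Mmax a b : a \in M -> r a b = false by case/maximalsP.
pose H := \max_(b : T) h b.
(* The induction hypothesis does not confine [D] to [R], hence the intersection; [H.+1] exceeds
   every value of [h], putting [M] on top. *)
exists (D :&: R), (fun a => if a \in R then h a else H.+1); split.
- move=> x y /setIP[xD xR]; rewrite in_setD in_setI => /andP[yDR /UP[yR|yM]].
    rewrite yR andbT in yDR.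
    by have := rD x y xD; rewrite in_setD yDR yR => /(_ isT)/andP[].
  exact: topRM.
- have hH a : h a < H.+1 by rewrite ltnS /H leq_bigmax.
  move=> x y; rewrite !in_setD !in_setI /= => /andP[xD Ux] /andP[yD Uy].
  case: (UP _ Ux) => [xR|xM]; last first.
    rewrite Mmax // (MR x xM).
    by case: (y \in R); rewrite ?ltnn // ltnNge ltnW.
  rewrite xR; case: (UP _ Uy) => [yR|yM]; last first.
    by rewrite topRM // MR // hH.
  rewrite yR; rewrite xR yR !andbT in xD yD.
  by rewrite -rh ?in_setD ?xD ?yD ?xR ?yR // andbT.
move=> z S zS; have [cS rS aS] := starsP _ _ _ zS.
(* A leaf in [M] forces all leaves into [M], away from [R]; otherwise the star survives in the
   restriction to [R]. *)
have [/exists_inP[s Ss sM]|noM] := boolP [exists s in S, s \in M].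
  have /subsetP SM := star_in_maximals ropt.1 top zS sM Ss.
  rewrite -setI_eq0; apply/eqP/setP => a; rewrite !in_setI in_set0.
  by apply/negP => /and3P[/SM/MR ->].
have zS0 : (z, S) \in stars (fun a b => r a b && (b \in R)).
  apply/starsP; split=> // [a Sa|a b Sa Sb]; last by rewrite negb_and aS.
  rewrite rS //=; have [_ /UP[//|aM]] := andP (rU _ _ (rS a Sa)).
  by move/exists_inPn: noM => /(_ a Sa); rewrite aM.
by apply: disjointWr (starsD _ _ zS0); apply: subsetIl.
Qed.

End Relations.

Arguments stars {T} l r.
Arguments starsP {T l r z S}.

Import Order.Theory.

(** * Passage from strict relations to posets, and isomorphisms *)

Section RelationPoset.

Variables (T : finType) (r : rel T).
Hypotheses (rI : irreflexive r) (rT : transitive r).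

(** An alias of [T] to be ordered by the reflexive closure of [r]; the proofs are arguments so that
    the order instance can use them. *)
Definition relposet of irreflexive r & transitive r : Type := T.

Notation RP := (relposet rI rT).

HB.instance Definition _ := Finite.on RP.

Fact relposet_lt_def (x y : RP) : r x y = (y != x) && ((x == y) || r x y).
Proof. by rewrite eq_sym; case: eqVneq => [->|] //=; rewrite rI. Qed.

Fact relposet_le_refl : reflexive (fun x y : RP => (x == y) || r x y).
Proof. by move=> x; rewrite eqxx. Qed.

Fact relposet_le_anti : antisymmetric (fun x y : RP => (x == y) || r x y).
Proof.
move=> x y; rewrite (eq_sym y); case: eqVneq => //= _ /andP[xy yx].
by have := rT xy yx; rewrite rI.
Qed.

Fact relposet_le_trans : transitive (fun x y : RP => (x == y) || r x y).
Proof.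
move=> y x z /orP[/eqP->//|xy] /orP[/eqP<-|yz]; first by rewrite xy orbT.
by rewrite (rT xy yz) orbT.
Qed.

HB.instance Definition _ := Order.isPOrder.Build poset_display RP
  relposet_lt_def relposet_le_refl relposet_le_anti relposet_le_trans.

End RelationPoset.

Section Isomorphisms.

Variables (d1 d2 : Order.disp_t) (P : finPOrderType d1) (Q : finPOrderType d2).

(** Order reflection and antisymmetry make [f] injective; the size bound then makes it bijective. *)
Lemma mono_order_iso (f : P -> Q) :
  {mono f : x y / (x <= y)%O} -> #|Q| <= #|P| -> order_iso f.
Proof.
move=> f_mono cQP; split=> //; apply: inj_card_bij => // x y fxy.
by apply: le_anti; rewrite -!f_mono fxy lexx.
Qed.

Lemma order_iso_inv (f : P -> Q) : order_iso f ->
  exists g : Q -> P, [/\ cancel f g, cancel g f & order_iso g].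
Proof.
case=> [[g fg gf] f_mono]; exists g; split=> //; split; first by exists f.
by move=> x y; rewrite -f_mono !gf.
Qed.

End Isomorphisms.

Lemma isomorphic_sym d1 d2 (P : finPOrderType d1) (Q : finPOrderType d2) :
  isomorphic P Q -> isomorphic Q P.
Proof.
by case/isomorphicP => f /order_iso_inv[g [_ _ gI]]; apply/isomorphicP; exists g.
Qed.

(** * Copies of the star as pairs of apex and leaf set *)

Section Copies.

Variables (l : nat) (d : Order.disp_t) (P : finPOrderType d).

Let lt : rel P := fun x y => (x < y)%O.

Lemma star_copyP (A : {set P}) :
  reflect (exists2 p, p \in stars l lt & A = p.1 |: p.2)
          (isomorphic (induced A) (star l)).
Proof.
apply: (iffP idP) => [/isomorphic_sym/isomorphicP[g [g_bij g_mono]]|].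
  have g_inj := bij_inj g_bij.
  pose z := val (g (inl ord0)); pose leaf (i : 'I_l) := val (g (inr i)).
  have leaf_inj : injective leaf by move=> i j /val_inj/g_inj[].
  exists (z, [set leaf i | i : 'I_l]) => /=.
    apply/starsP; split=> [|_ /imsetP[i _ ->]|_ _ /imsetP[i _ ->] /imsetP[j _ ->]].
    - by rewrite card_imset // card_ord.
    - rewrite /lt lt_def; apply/andP; split.
        by apply/eqP => /val_inj/g_inj.
      by have := g_mono (inl ord0) (inr i).
    - apply/negP; rewrite /lt lt_def => /andP[ij le_ij].
      have := g_mono (inr i) (inr j); rewrite [RHS]/Order.le /= /antichain_le.
      have -> : (g (inr i) <= g (inr j))%O by [].
      by move=> /esym/eqP ij'; rewrite ij' eqxx in ij.
  apply/setP => a; apply/idP/setU1P => [aA|[->|/imsetP[i _ ->]]]; last first.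
  - exact: valP.
  - exact: valP.
  have [h gh hg] := g_bij; have := hg (exist _ a aA).
  case: (h _) => [i|i] /(congr1 val) /= <-; last by right; apply: imset_f.
  by left; congr (val (g (inl _))); rewrite [i]ord1.
case=> -[z S] /starsP[cS zS aS] /= ->.
have zA : z \in z |: S by apply: setU11.
have SA (i : 'I_#|S|) : enum_val i \in z |: S by rewrite setU1r // enum_valP.
pose g (u : star l) : induced (z |: S) :=
  match u with
  | inl _ => exist (fun x => x \in z |: S) z zA
  | inr i => exist (fun x => x \in z |: S) _ (SA (cast_ord (esym cS) i))
  end.
have zNS : z \notin S by apply/negP => /zS; rewrite /lt ltxx.
apply: isomorphic_sym; apply/isomorphicP; exists g; apply: mono_order_iso; last first.
  by rewrite card_sig cardsU1 zNS cS card_sum !card_ord.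
have leafS i : enum_val (cast_ord (esym cS) i) \in S by apply: enum_valP.
move=> u v; rewrite -[LHS]/(val (g u) <= val (g v))%O.
case: u v => [i|i] [j|j]; rewrite [RHS]/Order.le /=.
- by rewrite [i]ord1 [j]ord1 !lexx.
- by apply: ltW; apply: zS.
- by apply/negbTE/negP => le_iz; have := le_lt_trans le_iz (zS _ (leafS i)); rewrite ltxx.
- apply/idP/eqP => [|->]; last exact: lexx.
  rewrite le_eqVlt => /orP[/eqP/enum_val_inj/cast_ord_inj //|].
  by move=> ij; case/negP: (aS _ _ (leafS i) (leafS j)).
Qed.

(** The apex is the least element of a copy, so the subset determines the pair. *)
Lemma copies_star : copies (star l) P = #|stars l lt|.
Proof.
have -> : #|stars l lt| = #|[set p.1 |: p.2 | p in stars l lt]|.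
  apply/esym/card_in_imset => -[z S] [z' S'] /starsP[cS zS aS] /starsP[cS' zS' aS'] /= E.
  have zE : z = z'.
    (* If the apexes differed, each would be a leaf of the other star, hence strictly above the
       other. *)
    apply: contraTeq (setU11 z S) => zz'; rewrite E in_setU1 (negbTE zz') /=.
    apply/negP => /zS' z'z; have := setU11 z' S'.
    rewrite -E in_setU1 eq_sym (negbTE zz') => /zS zz.
    by have := lt_trans z'z zz; rewrite ltxx.
  have zNS : z \notin S by apply/negP => /zS; rewrite /lt ltxx.
  have zNS' : z \notin S' by rewrite zE; apply/negP => /zS'; rewrite /lt ltxx.
  by rewrite -zE in E *; congr (_, _); rewrite -(setU1K zNS) E setU1K.
apply: eq_card => A; rewrite inE; apply/star_copyP/imsetP => -[p pS ->]; by exists p.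
Qed.

End Copies.

(** Each competing relation becomes a poset of the same size through [relposet], so maximality among
    posets covers it. *)
Lemma optimal_on_setT l d (P : finPOrderType d) :
  optimal (star l) P -> optimal_on l [set: P] (fun x y => (x < y)%O).
Proof.
move=> [_ Pmax]; split.
  by split=> [x|y x z|x y _]; [apply: ltxx | apply: lt_trans | rewrite !inE].
move=> r [rI rT _].
have := Pmax _ (relposet rI rT : finPOrderType _) erefl.
by rewrite !copies_star.
Qed.

(** * Layered posets from rank functions, and the decomposition *)

Lemma layered_rank d (P : finPOrderType d) (h : P -> nat) :
  (forall x y, (x < y)%O = (h x < h y)) -> layered P.
Proof.
have [n] : exists n, forall x, h x < n.
  by exists (\max_(x : P) h x).+1 => x; rewrite ltnS leq_bigmax.
elim: n => [|n IHn] in d P h * => h_lt ltE.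
  (* No value of [h] lies below the bound 0, so [P] is empty. *)
  exists [::]; apply: isomorphic_sym; apply/isomorphicP.
  exists (fun i : antichain 0 => match notF (ltn_ord i : false) with end).
  apply: mono_order_iso; first by case.
  by rewrite eq_card0 // => x; have := h_lt x.
pose A := [set x : P | h x == 0].
have hA u : u \in A -> h u = 0 by rewrite inE => /eqP.
have hNA u : u \in ~: A -> 0 < h u by rewrite !inE lt0n.
(* Off level 0 the values of [h] are positive, so lowering them by one keeps their order. *)
have [u|u v|ns /isomorphic_sym/isomorphicP[g [g_bij g_mono]]] :=
  IHn _ (induced (~: A) : finPOrderType _) (fun u => (h (val u)).-1).
- by move: (h_lt (val u)) (hNA _ (valP u)) => /=; lia.
- rewrite -[LHS]/(val u < val v)%O ltE.
  by move: (hNA _ (valP u)) (hNA _ (valP v)) => /=; lia.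
(* Level 0 is the bottom antichain; it may be empty, as [layered] admits zero entries. *)
exists (#|A| :: ns); apply: isomorphic_sym; apply/isomorphicP.
pose f (u : ordsum (antichain #|A|) (antichain_sum ns)) : P :=
  match u with inl i => enum_val i | inr q => val (g q) end.
exists f; apply: mono_order_iso; last first.
  by rewrite card_sum card_ord (bij_eq_card g_bij) card_sig [X in _ <= _ + X]cardsCs setCK subnKC ?max_card.
have lt_f i q : (f (inl i) < f (inr q))%O.
  by rewrite ltE /= (hA (enum_val i)) ?enum_valP // hNA // (valP (g q)).
case=> [i|q] [j|q']; rewrite [RHS]/Order.le /=.
- apply/idP/eqP => [|->]; last exact: lexx.
  by rewrite le_eqVlt ltE /= !hA ?enum_valP // orbF => /eqP/enum_val_inj.
- exact/ltW/lt_f.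
- by apply/negbTE; rewrite lt_geF ?lt_f.
- exact: g_mono.
Qed.

Theorem theorem7p3 (l : nat) (hl : 2 <= l) (d : Order.disp_t)
    (P : finPOrderType d) :
  optimal (star l) P -> has_l_decomposition l P.
Proof.
move/optimal_on_setT/(optimal_decomposition hl) => [D [h [ltD ltE starD]]].
pose P1 : finPOrderType poset_display := induced D.
pose P2 : finPOrderType poset_display := induced (~: D).
pose f (u : ordsum P1 P2) : P := match u with inl p => val p | inr q => val q end.
have inC (q : P2) : val q \in [set: P] :\: D by rewrite setTD (valP q).
have lt_f p q : (f (inl p) < f (inr q))%O by apply: ltD; rewrite ?inC ?(valP p).
exists poset_display, poset_display, P1, P2, f; split.
- apply: mono_order_iso; last first.
    by rewrite card_sum !card_sig [X in _ <= _ + X]cardsCs setCK subnKC ?max_card.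
  case=> [p|q] [p'|q']; rewrite [RHS]/Order.le //=.
    exact/ltW/lt_f.
  by apply/negbTE; rewrite lt_geF ?lt_f.
- apply: (@layered_rank _ P2 (fun q => h (val q))) => q q'.
  by rewrite -ltE ?inC.
move=> A /(star_copyP)[[z S] /= zS ->].
(* The leaves avoid [D], so only the apex can lie in the lower summand. *)
apply: leq_trans (_ : #|[set z]| <= 1); last by rewrite cards1.
apply/subset_leq_card/subsetP => a; rewrite in_setI => /andP[/setU1P[->|aS]].
  by rewrite set11.
case/imsetP => p _ aE; have := disjointFr (starD _ _ zS) aS.
by rewrite aE (valP p).
Qed.
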